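(* Let $d,r\ge 2$ and $e\ge 1$. The braid group $B(de,e,r)$ has the following presentation. Generators: $\{z\}\cup T\cup S$ where $T=\{t_i\mid i\in\mathbb{Z}\}$ and $S=\{s_j\mid 3\le j\le r\}$. Relations: the usual braid relations on $S$, along with - $(Q_1)$ $t_it_{i-1}=t_jt_{j-1}$ for $i,j\in\mathbb{Z}$; - $(Q_2)$ $s_3t_is_3=t_is_3t_i$ for $i\in\mathbb{Z}$; - $(Q_3)$ $s_jt_i=t_is_j$ for $i\in\mathbb{Z}$ and $4\le j\le r$; - $(Q_4)$ $zt_i=t_{i-e}z$ for $i\in\mathbb{Z}$; - $(Q_5)$ $zs_j=s_jz$ for $3\le j\le r$. (Here $z,t_0,t_1,s_3,\ldots,s_r$ are the generators of the Broué–Malle–Rouquier presentation of $B(de,e,r)$.)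
   Context: The usual braid relations on $S=\{s_3,\ldots,s_r\}$ are $s_is_j=s_js_i$ for $|i-j|\ge 2$ and $s_is_{i+1}s_i=s_{i+1}s_is_{i+1}$ for $3\le i\le r-1$. If $r=2$ then $S=\emptyset$ and all relations involving some $s_j$ are absent. For $k\ge0$, $\langle b_1b_2\cdots b_l\rangle^k$ denotes the cyclic product $b_1b_2\cdots b_lb_1b_2\cdots$ with exactly $k$ factors; e.g. $\langle t_1t_0\rangle^3=t_1t_0t_1$. $G(de,e,r)$ is the complex reflection group of $r\times r$ monomial matrices whose nonzero entries are $de$-th roots of unity and such that the $d$-th power of the product of the nonzero entries is $1$. $B(de,e,r)$ is its braid group (the fundamental group of the space of regular orbits). By Broué–Malle–Rouquier, for $d,r\ge2$ and $e\ge1$ it is (and may be taken by definition to be) the group with generators $\{z\}\cup\{t_0,t_1\}\cup S$ and relations: the usual braid relations on $S$; $(R_1)$ $zt_1t_0=t_1t_0z$; $(R_2)$ $z\langle t_1t_0\rangle^e=t_0z\langle t_1t_0\rangle^{e-1}$; $(R_3)$ $zs_j=s_jz$ for $3\le j\le r$; $(R_4)$ $s_3t_is_3=t_is_3t_i$ for $i=0,1$; $(R_5)$ $s_3(t_1t_0)s_3(t_1t_0)=(t_1t_0)s_3(t_1t_0)s_3$; $(R_6)$ $s_jt_i=t_is_j$ for $i=0,1$ and $4\le j\le r$. *)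

(* Defs.v *)
From HB Require Import structures.
From mathcomp Require Import all_boot all_algebra.
From mathcomp Require Import generic_quotient boolp.

Set Implicit Arguments.
Unset Strict Implicit.
Unset Printing Implicit Defensive.

Import GRing.Theory.

(* A word in the letters [X] and their formal inverses: [(x, true)] stands for
   x and [(x, false)] for x^-1. *)
Definition word (X : Type) : Type := seq (X * bool).

Definition posw (X : Type) (s : seq X) : word X := [seq (x, true) | x <- s].

Definition invw (X : Type) (u : word X) : word X :=
  rev [seq (a.1, ~~ a.2) | a <- u].

(* [R u v] means that u = v is a defining relation. *)
Inductive word_eqv (X : Type) (R : word X -> word X -> Prop) :
    word X -> word X -> Prop :=
| WordRel u v : R u v -> word_eqv R u v
| WordCancel x b : word_eqv R [:: (x, b); (x, ~~ b)] [::]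
| WordRefl u : word_eqv R u u
| WordSym u v : word_eqv R u v -> word_eqv R v u
| WordTrans u v w : word_eqv R u v -> word_eqv R v w -> word_eqv R u w
| WordCat u1 v1 u2 v2 :
    word_eqv R u1 v1 -> word_eqv R u2 v2 -> word_eqv R (u1 ++ u2) (v1 ++ v2).

Section PresentedGroup.
Variables (X : choiceType) (R : word X -> word X -> Prop).

Definition word_eqvb : rel (seq (X * bool)) := fun u v => `[< word_eqv R u v >].

Lemma word_eqvb_refl : reflexive word_eqvb.
Proof. by move=> u; apply/asboolP; exact: WordRefl. Qed.

Lemma word_eqvb_sym : symmetric word_eqvb.
Proof. by move=> u v; apply/asboolP/asboolP; exact: WordSym. Qed.

Lemma word_eqvb_trans : transitive word_eqvb.
Proof.
by move=> v u w /asboolP uv /asboolP vw; apply/asboolP; exact: WordTrans uv vw.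
Qed.

Canonical word_equiv :=
  EquivRel word_eqvb word_eqvb_refl word_eqvb_sym word_eqvb_trans.

Definition presented_group : Type := {eq_quot word_equiv}%qT.
HB.instance Definition _ := Choice.on presented_group.

Definition pres_class (u : word X) : presented_group :=
  \pi_({eq_quot word_equiv})%qT u.

Definition pres_repr (g : presented_group) : word X :=
  repr (g : {eq_quot word_equiv}%qT).

Definition pres_gen (x : X) : presented_group := pres_class (posw [:: x]).

Lemma pres_reprK : cancel pres_repr pres_class.
Proof. exact: reprK. Qed.

Lemma pres_classP u v : pres_class u = pres_class v <-> word_eqv R u v.
Proof. by split=> [/eqmodP/asboolP|uv]; [|apply/eqmodP/asboolP]. Qed.

Lemma word_eqv_mulV u : word_eqv R (u ++ invw u) [::].
Proof.
elim: u => [|[x b] u IHu]; first exact: WordRefl.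
rewrite /invw /= rev_cons -cats1 catA.
have step : word_eqv R ([:: (x, b)] ++ (u ++ invw u) ++ [:: (x, ~~ b)])
    ([:: (x, b)] ++ [::] ++ [:: (x, ~~ b)]).
  by apply: WordCat (WordRefl _ _) _; exact: WordCat IHu (WordRefl _ _).
by apply: WordTrans step _; exact: WordCancel.
Qed.

Lemma invwK : involutive (@invw X).
Proof.
move=> u; rewrite /invw map_rev revK -map_comp map_id_in // => -[x b] _ /=.
by rewrite negbK.
Qed.

Lemma word_eqv_Vmul u : word_eqv R (invw u ++ u) [::].
Proof. by rewrite -{2}[u]invwK; exact: word_eqv_mulV. Qed.

Lemma word_eqv_inv u v : word_eqv R u v -> word_eqv R (invw u) (invw v).
Proof.
move=> uv; apply: (@WordTrans _ _ _ (invw u ++ v ++ invw v)).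
  rewrite -{1}[invw u]cats0; apply: WordCat (WordRefl _ _) _.
  by apply: WordSym; exact: word_eqv_mulV.
rewrite catA -[X in word_eqv _ _ X]cat0s; apply: WordCat (WordRefl _ _).
apply: WordTrans (word_eqv_Vmul u).
by apply: WordCat (WordRefl _ _) _; exact: WordSym.
Qed.

Definition pres_one := pres_class [::].
Definition pres_mul g h := pres_class (pres_repr g ++ pres_repr h).
Definition pres_inv g := pres_class (invw (pres_repr g)).

Lemma pres_repr_class u : word_eqv R (pres_repr (pres_class u)) u.
Proof. by apply/pres_classP; rewrite pres_reprK. Qed.

Lemma pres_mulE u v :
  pres_mul (pres_class u) (pres_class v) = pres_class (u ++ v).
Proof. by apply/pres_classP; apply: WordCat; exact: pres_repr_class. Qed.

Lemma pres_invE u : pres_inv (pres_class u) = pres_class (invw u).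
Proof. by apply/pres_classP; apply: word_eqv_inv; exact: pres_repr_class. Qed.

Lemma pres_mulA : associative pres_mul.
Proof.
move=> f g h; rewrite -[f]pres_reprK -[g]pres_reprK -[h]pres_reprK.
by rewrite !pres_mulE catA.
Qed.

Lemma pres_mul1 : left_id pres_one pres_mul.
Proof. by move=> g; rewrite -[g]pres_reprK pres_mulE. Qed.

Lemma pres_mulr1 : right_id pres_one pres_mul.
Proof. by move=> g; rewrite -[g]pres_reprK pres_mulE cats0. Qed.

Lemma pres_mulV : left_inverse pres_one pres_inv pres_mul.
Proof.
move=> g; rewrite -[g]pres_reprK pres_invE pres_mulE; apply/pres_classP.
exact: word_eqv_Vmul.
Qed.

Lemma pres_mulrV : right_inverse pres_one pres_inv pres_mul.
Proof.
move=> g; rewrite -[g]pres_reprK pres_invE pres_mulE; apply/pres_classP.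
exact: word_eqv_mulV.
Qed.

HB.instance Definition _ := isGroup.Build presented_group
  pres_mulA pres_mul1 pres_mulr1 pres_mulV pres_mulrV.

End PresentedGroup.

(* < X | R > is a presentation of G, where x : X denotes the element [gen x]. *)
Definition has_presentation (G : groupType) (X : choiceType) (gen : X -> G)
    (R : word X -> word X -> Prop) : Prop :=
  exists f : {multiplicative presented_group R -> G},
    bijective f /\ forall x, f (pres_gen R x) = gen x.

(* <b_1 b_2 ... b_l>^k, for a nonempty sequence b. *)
Definition cyclic_prod (X : Type) (b : seq X) (k : nat) : seq X :=
  take k (flatten (nseq k b)).

(* The index set of s_3, ..., s_r; it is empty when r = 2. *)
Definition sidx (r : nat) : choiceType := {j : nat | 3 <= j <= r}.

Inductive usual_braid_rel (r : nat) (X : Type) (s : sidx r -> X) :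
    word X -> word X -> Prop :=
| BraidComm (i j : sidx r) : 2 <= `|val i - val j| ->
    usual_braid_rel s (posw [:: s i; s j]) (posw [:: s j; s i])
| BraidBraid (i j : sidx r) : val j = (val i).+1 ->
    usual_braid_rel s (posw [:: s i; s j; s i]) (posw [:: s j; s i; s j]).

Inductive bmr_gen (r : nat) : Type :=
| bmr_z
| bmr_t0
| bmr_t1
| bmr_s of sidx r.
Arguments bmr_z {r}.
Arguments bmr_t0 {r}.
Arguments bmr_t1 {r}.

HB.instance Definition _ (r : nat) := gen_eqMixin (bmr_gen r).
HB.instance Definition _ (r : nat) := gen_choiceMixin (bmr_gen r).

Inductive bmr_rel (e r : nat) : word (bmr_gen r) -> word (bmr_gen r) -> Prop :=
| BMR_braid u v : usual_braid_rel (@bmr_s r) u v -> bmr_rel e u v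
| BMR_R1 :
    bmr_rel e (posw [:: bmr_z; bmr_t1; bmr_t0]) (posw [:: bmr_t1; bmr_t0; bmr_z])
| BMR_R2 :
    bmr_rel e (posw (bmr_z :: cyclic_prod [:: bmr_t1; bmr_t0] e))
      (posw [:: bmr_t0, bmr_z & cyclic_prod [:: bmr_t1; bmr_t0] e.-1])
| BMR_R3 (j : sidx r) :
    bmr_rel e (posw [:: bmr_z; bmr_s j]) (posw [:: bmr_s j; bmr_z])
| BMR_R4 (s3 : sidx r) (t : bmr_gen r) :
    val s3 = 3 -> t = bmr_t0 \/ t = bmr_t1 ->
    bmr_rel e (posw [:: bmr_s s3; t; bmr_s s3]) (posw [:: t; bmr_s s3; t])
| BMR_R5 (s3 : sidx r) : val s3 = 3 ->
    bmr_rel e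
      (posw [:: bmr_s s3; bmr_t1; bmr_t0; bmr_s s3; bmr_t1; bmr_t0])
      (posw [:: bmr_t1; bmr_t0; bmr_s s3; bmr_t1; bmr_t0; bmr_s s3])
| BMR_R6 (j : sidx r) (t : bmr_gen r) :
    4 <= val j -> t = bmr_t0 \/ t = bmr_t1 ->
    bmr_rel e (posw [:: bmr_s j; t]) (posw [:: t; bmr_s j]).

(* B(de,e,r) for d, r >= 2 and e >= 1, defined by the presentation of Broué,
   Malle and Rouquier; the defining relations do not involve d. *)
Definition braid_group (d e r : nat) : groupType :=
  presented_group (@bmr_rel e r).

Definition bg_gen (d e r : nat) (x : bmr_gen r) : braid_group d e r :=
  pres_gen (@bmr_rel e r) x.

Inductive dual_gen (r : nat) : Type :=
| dual_z
| dual_t of int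
| dual_s of sidx r.
Arguments dual_z {r}.
Arguments dual_t {r} i.

HB.instance Definition _ (r : nat) := gen_eqMixin (dual_gen r).
HB.instance Definition _ (r : nat) := gen_choiceMixin (dual_gen r).

Inductive dual_rel (e r : nat) :
    word (dual_gen r) -> word (dual_gen r) -> Prop :=
| Dual_braid u v : usual_braid_rel (@dual_s r) u v -> dual_rel e u v
| Dual_Q1 (i j : int) :
    dual_rel e (posw [:: dual_t i; dual_t (i - 1)%R])
      (posw [:: dual_t j; dual_t (j - 1)%R])
| Dual_Q2 (s3 : sidx r) (i : int) : val s3 = 3 ->
    dual_rel e (posw [:: dual_s s3; dual_t i; dual_s s3])
      (posw [:: dual_t i; dual_s s3; dual_t i])
| Dual_Q3 (j : sidx r) (i : int) : 4 <= val j ->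
    dual_rel e (posw [:: dual_s j; dual_t i]) (posw [:: dual_t i; dual_s j])
| Dual_Q4 (i : int) :
    dual_rel e (posw [:: dual_z; dual_t i])
      (posw [:: dual_t (i - e%:Z)%R; dual_z])
| Dual_Q5 (j : sidx r) :
    dual_rel e (posw [:: dual_z; dual_s j]) (posw [:: dual_s j; dual_z]).

(* Main.v *)
(** Given t_0 and t_1, the relations t_i t_(i-1) = D with D = t_1 t_0 determine
    all the t_i: every family satisfying them is recovered from t_0 and t_1 by
    the recursion t_(i+1) = D t_i^-1.  With the t_i so defined, the two sets of
    relations are equivalent in any group.  Since D t_i = t_(i+2) D, the cyclic
    products satisfy <t_1 t_0>^e = t_e <t_1 t_0>^(e-1), so (R_2) says exactly
    z t_e = t_0 z; as z commutes with D, this propagates to all of (Q_4).  When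
    s_3 is braided with two consecutive t_i, being braided with the next (or the
    previous) one is equivalent to (R_5), so (R_4) and (R_5) propagate to
    (Q_2). *)

From HB Require Import structures.
Require Import Defs.
From mathcomp Require Import all_boot all_algebra.

Set Implicit Arguments.
Unset Strict Implicit.
Unset Printing Implicit Defensive.

(** * The universal property of a presented group *)

Section UniversalProperty.
Local Open Scope group_scope.

Definition word_eval (X : Type) (G : groupType) (f : X -> G) (w : word X) : G :=
  \prod_(a <- w) (if a.2 then f a.1 else (f a.1)^-1).

Lemma word_eval_nil (X : Type) (G : groupType) (f : X -> G) :
  word_eval f [::] = 1.
Proof. exact: big_nil. Qed.

Lemma word_eval_cat (X : Type) (G : groupType) (f : X -> G) (u v : word X) :
  word_eval f (u ++ v) = word_eval f u * word_eval f v.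
Proof. exact: big_cat. Qed.

Lemma word_eval_posw (X : Type) (G : groupType) (f : X -> G) (s : seq X) :
  word_eval f (posw s) = \prod_(x <- s) f x.
Proof. exact: big_map. Qed.

Definition satisfies (X : Type) (R : word X -> word X -> Prop) (G : groupType)
    (f : X -> G) : Prop :=
  forall u v, R u v -> word_eval f u = word_eval f v.

Lemma word_eval_eqv (X : Type) (R : word X -> word X -> Prop) (G : groupType)
    (f : X -> G) (u v : word X) :
  satisfies R f -> word_eqv R u v -> word_eval f u = word_eval f v.
Proof.
move=> fR; elim=> {u v} //.
- by move=> x b; rewrite /word_eval !big_cons !big_nil mulg1;
    case: b; rewrite /= ?mulgV ?mulVg.
- by move=> u v w _ -> _ ->.
- by move=> u1 v1 u2 v2 _ eq1 _ eq2; rewrite !word_eval_cat eq1 eq2.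
Qed.

Variables (X : choiceType) (R : word X -> word X -> Prop).

Lemma pres_mul_class (u v : word X) :
  pres_class R u * pres_class R v = pres_class R (u ++ v).
Proof. exact: pres_mulE. Qed.

Lemma pres_inv_class (u : word X) :
  (pres_class R u)^-1 = pres_class R (invw u).
Proof. exact: pres_invE. Qed.

Lemma word_eval_pres_gen (w : word X) :
  word_eval (pres_gen R) w = pres_class R w.
Proof.
elim: w => [|[x b] w IHw]; first exact: word_eval_nil.
by rewrite /word_eval big_cons -/(word_eval _ w) IHw /=; case: b;
  rewrite /pres_gen ?pres_inv_class pres_mul_class.
Qed.

Lemma satisfies_pres_gen : satisfies R (pres_gen R).
Proof.
by move=> u v Ruv; rewrite !word_eval_pres_gen; apply/pres_classP/WordRel.
Qed.

Section Lift.
Variables (G : groupType) (f : X -> G) (fR : satisfies R f).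

(** The induced map evaluates a chosen representative; [satisfies R f] makes the value independent
    of that choice. *)
Definition pres_lift (g : presented_group R) : G := word_eval f (pres_repr g).

Lemma pres_lift_class (w : word X) :
  pres_lift (pres_class R w) = word_eval f w.
Proof. exact: word_eval_eqv (pres_repr_class R w). Qed.

Lemma pres_liftM : {morph pres_lift : g h / g * h}.
Proof.
move=> g h; rewrite -(pres_reprK g) -(pres_reprK h) pres_mul_class.
by rewrite !pres_lift_class word_eval_cat.
Qed.

Lemma pres_lift1 : pres_lift 1 = 1.
Proof. by rewrite pres_lift_class word_eval_nil. Qed.

Lemma pres_lift_gen (x : X) : pres_lift (pres_gen R x) = f x.
Proof. by rewrite pres_lift_class word_eval_posw big_seq1. Qed.

Lemma pres_lift_comp (H : groupType) (h : G -> H) :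
    h 1 = 1 -> {morph h : x y / x * y} ->
  forall g, h (pres_lift g) = word_eval (h \o f) (pres_repr g).
Proof.
move=> h1 hM g; rewrite /pres_lift; elim: (pres_repr g) => [|[x b] w IHw].
  by rewrite !word_eval_nil.
rewrite /word_eval !big_cons -!/(word_eval _ w) hM IHw /=; case: b => //=.
by congr (_ * _); apply: (mulgI (h (f x))); rewrite -hM !mulgV.
Qed.

End Lift.
End UniversalProperty.

(** The two lifts are mutually inverse, since each composite is a morphism fixing the generators. *)
Lemma has_presentation_lift (X Y : choiceType)
    (R : word X -> word X -> Prop) (Q : word Y -> word Y -> Prop)
    (f : X -> presented_group Q) (g : Y -> presented_group R)
    (fR : satisfies R f) (gQ : satisfies Q g) :
    (forall x, pres_lift g (f x) = pres_gen R x) ->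
    (forall y, pres_lift f (g y) = pres_gen Q y) ->
  has_presentation f R.
Proof.
move=> gf fg.
pose phi := HB.pack_for {multiplicative presented_group R -> presented_group Q}
  (pres_lift f) (isMultiplicative.Build _ _ (pres_lift f) (pres_liftM fR)).
exists phi; split; last exact: pres_lift_gen.
exists (pres_lift g) => k /=.
- rewrite (pres_lift_comp f (pres_lift1 gQ) (pres_liftM gQ)).
  rewrite -[RHS]pres_reprK -word_eval_pres_gen; apply: eq_bigr => a _ /=.
  by rewrite gf.
- rewrite (pres_lift_comp g (pres_lift1 fR) (pres_liftM fR)).
  rewrite -[RHS]pres_reprK -word_eval_pres_gen; apply: eq_bigr => a _ /=.
  by rewrite fg.
Qed.

(** * Sequences with constant product of consecutive terms *)

Lemma int_ind_from (P : int -> Prop) (i0 : int) :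
    P i0 -> (forall i, P i -> P (i + 1)%R) -> (forall i, P (i + 1)%R -> P i) ->
  forall i, P i.
Proof.
move=> P0 up down i; rewrite -[i](GRing.subrK i0) GRing.addrC.
elim: (i - i0)%R => [|n IHn|n IHn]; first by rewrite GRing.addr0.
  by rewrite -addn1 PoszD GRing.addrA; exact: up.
by apply: down; rewrite -addn1 PoszD GRing.opprD -GRing.addrA GRing.subrK.
Qed.

Lemma cyclic_prodSS (X : Type) (a b : X) (n : nat) :
  cyclic_prod [:: a; b] n.+2 = [:: a, b & cyclic_prod [:: a; b] n].
Proof.
have -> : cyclic_prod [:: a; b] n.+2 =
    [:: a, b & take n (flatten (nseq (n + 1) [:: a; b]))] by rewrite addn1.
(* The first n copies already contain 2n letters, so the extra copy is never reached. *)
rewrite nseqD flatten_cat takel_cat //.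
by rewrite size_flatten /shape map_nseq sumn_nseq leq_pmull.
Qed.

Lemma map_cyclic_prod (X Y : Type) (f : X -> Y) (b : seq X) (n : nat) :
  [seq f x | x <- cyclic_prod b n] = cyclic_prod [seq f x | x <- b] n.
Proof. by rewrite /cyclic_prod map_take map_flatten map_nseq. Qed.

Section ConstantProduct.
Local Open Scope group_scope.
Variables (G : groupType) (u : int -> G) (D : G).
Hypothesis uD : forall i, u (i + 1)%R * u i = D.

Lemma const_prod_succ i : u (i + 1)%R = D / u i.
Proof. by rewrite -(uD i) mulgK. Qed.

Lemma const_prod_pred i : u i = (u (i + 1)%R)^-1 * D.
Proof. by rewrite -(uD i) mulKg. Qed.

(** Both sides equal [u (i + 2) * u (i + 1) * u i]: conjugation by [D] shifts indices by 2. *)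
Lemma const_prod_succ2 i : D * u i = u (i + 2)%R * D.
Proof.
by rewrite -[in RHS](uD i) -{1}(uD (i + 1)%R) -GRing.addrA -!mulgA.
Qed.

Lemma const_prod_commute (s : G) :
  commute s D -> commute s (u 0%R) -> forall i, commute s (u i).
Proof.
move=> sD s0; apply: (@int_ind_from (fun i => commute s (u i)) 0%R) => // i si.
  by rewrite const_prod_succ; apply: commuteM => //; exact: commuteV.
by rewrite const_prod_pred; apply: commuteM => //; exact: commuteV.
Qed.

(** Replacing [D] by two consecutive terms on each side of z D = D z and cancelling the known
    relation gives the neighbouring one. *)
Lemma const_prod_shift (z : G) (j k : int) :
    commute z D -> z * u j = u (j - k)%R * z ->
  forall i, z * u i = u (i - k)%R * z.
Proof.
move=> zD zj.
apply: (@int_ind_from (fun i => z * u i = u (i - k)%R * z) j) => // i zi.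
  rewrite GRing.addrAC; apply: (mulIg (u i)).
  by rewrite -!mulgA uD zi mulgA uD.
apply: (mulgI (u (i + 1 - k)%R)).
by rewrite mulgA -zi -mulgA uD mulgA GRing.addrAC uD.
Qed.

(** * Braid relations along the sequence *)

Definition braided (x y : G) : Prop := x * y * x = y * x * y.

(* Once s is braided with a and b, the two sides of (R_5) are
   (s c s) (a s b) and (c s c) (a s b). *)
Lemma braided_R5 (s a b c : G) :
    c * a = a * b -> braided s a -> braided s b ->
  braided s c <-> s * (a * b) * s * (a * b) = a * b * s * (a * b) * s.
Proof.
move=> ca sa sb.
have -> : s * (a * b) * s * (a * b) = s * c * s * (a * s * b).
  by rewrite -{1}ca -!mulgA (mulgA a s) (mulgA (a * s)) -sa !mulgA.
have -> : a * b * s * (a * b) * s = c * s * c * (a * s * b).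
  rewrite -{1}ca -!mulgA (mulgA a s) (mulgA (a * s)) -sa.
  by rewrite -!mulgA (mulgA s b) sb -!mulgA (mulgA c a) ca -!mulgA.
by split=> [->//|/mulIg].
Qed.

(* Likewise with (c s a) (b s b) and (c s a) (s b s). *)
Lemma braided_R5l (s a b c : G) :
    c * a = a * b -> braided s c -> braided s a ->
  braided s b <-> s * (a * b) * s * (a * b) = a * b * s * (a * b) * s.
Proof.
move=> ca sc sa.
have -> : s * (a * b) * s * (a * b) = c * s * a * (b * s * b).
  rewrite -{1}ca -!mulgA (mulgA a s) (mulgA (a * s)) -sa -!mulgA.
  by rewrite (mulgA s c) (mulgA (s * c)) sc -!mulgA (mulgA c a) ca -!mulgA.
have -> : a * b * s * (a * b) * s = c * s * a * (s * b * s).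
  by rewrite -{1}ca -!mulgA (mulgA a s) (mulgA (a * s)) -sa -!mulgA.
by split=> [->//|/mulgI].
Qed.

Lemma const_prod_braided (s : G) :
    s * D * s * D = D * s * D * s ->
    braided s (u 0%R) -> braided s (u 1%R) ->
  forall i, braided s (u i).
Proof.
(* The induction carries two consecutive indices, because the step to a third term uses both of its
   predecessors or both of its successors. *)
move=> sD s0 s1 i; suff [] : braided s (u i) /\ braided s (u (i + 1)%R) by [].
move: i; apply: (@int_ind_from
    (fun i => braided s (u i) /\ braided s (u (i + 1)%R)) 0%R) => //.
all: move=> i [si si1]; split=> //.
  apply/(braided_R5 _ si1 si); last by rewrite uD.
  by rewrite !uD.
apply/(braided_R5l _ si1 si); last by rewrite uD.
by rewrite !uD.
Qed.

(** Induction by steps of two: the leading pair of letters is [D], and moving [D] to the right past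
    a term raises its index by 2. *)
Lemma const_prod_cyclic n :
  \prod_(x <- cyclic_prod [:: u 1%R; u 0%R] n.+1) x =
  u n.+1 * \prod_(x <- cyclic_prod [:: u 1%R; u 0%R] n) x.
Proof.
pose P m := \prod_(x <- cyclic_prod [:: u 1%R; u 0%R] m) x.
have PSS m : P m.+2 = D * P m.
  by rewrite /P cyclic_prodSS 2!big_cons mulgA -(uD 0%R).
rewrite -/(P n) -/(P n.+1); elim/ltn_ind: n => -[|[|n]] IHn.
- by rewrite /P !big_cons !big_nil.
- rewrite PSS /P big_seq1 big_nil mulg1; exact: esym (uD 1%R).
- by rewrite !PSS IHn // !mulgA const_prod_succ2 -PoszD addn2.
Qed.

Lemma const_prod_uniq (v : int -> G) :
  (forall i, v (i + 1)%R * v i = D) -> u 0%R = v 0%R -> u =1 v.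
Proof.
move=> vD uv0; apply: (@int_ind_from (fun i => u i = v i) 0%R) => // i uvi.
  by apply: (mulIg (u i)); rewrite uD uvi vD.
by apply: (mulgI (u (i + 1)%R)); rewrite uD uvi vD.
Qed.
End ConstantProduct.

(** With D = b a, this solves u_(i+1) = D u_i^-1 forwards and u_i = u_(i+1)^-1 D backwards from u_0
    = a. As [Negz n] is -(n+1), it takes n+1 backward steps. *)
Definition const_prod_seq (G : groupType) (a b : G) (i : int) : G :=
  match i with
  | Posz n => iter n (fun x => b * a / x)%g a
  | Negz n => iter n.+1 (fun x => x^-1 * (b * a))%g a
  end.

Lemma const_prod_seqP (G : groupType) (a b : G) (i : int) :
  (const_prod_seq a b (i + 1)%R * const_prod_seq a b i = b * a)%g.
Proof.
(* Index -1 is treated apart: its successor 0 lies in the other branch of the definition. *)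
case: i => [n|[|n]]; first by rewrite -PoszD addn1 /= mulgVK.
  by rewrite /= mulVKg.
have -> : (Negz n.+1 + 1)%R = Negz n.
  by rewrite !NegzE -(addn1 n.+1) PoszD GRing.opprD GRing.subrK.
by rewrite [const_prod_seq a b (Negz n.+1)]/= mulVKg.
Qed.

Lemma const_prod_seq1 (G : groupType) (a b : G) : const_prod_seq a b 1%R = b.
Proof. exact: mulgK. Qed.

(** * The two presentations *)

Definition dual_of_bmr (r : nat) (x : bmr_gen r) : dual_gen r :=
  match x with
  | bmr_z => dual_z
  | bmr_t0 => dual_t 0%R
  | bmr_t1 => dual_t 1%R
  | bmr_s j => dual_s j
  end.

(** The only extension of [f] to all the t_i that is compatible with (Q_1). *)
Definition dual_family (r : nat) (G : groupType) (f : bmr_gen r -> G)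
    (x : dual_gen r) : G :=
  match x with
  | dual_z => f bmr_z
  | dual_t i => const_prod_seq (f bmr_t0) (f bmr_t1) i
  | dual_s j => f (bmr_s j)
  end.

Lemma satisfies_usual_braid (r : nat) (X Y : Type) (s : sidx r -> X)
    (t : sidx r -> Y) (G : groupType) (f : X -> G) (g : Y -> G) :
    f \o s =1 g \o t ->
  satisfies (usual_braid_rel s) f -> satisfies (usual_braid_rel t) g.
Proof.
move=> fg fR _ _ [] i j ij.
  have := fR _ _ (BraidComm s ij); rewrite !word_eval_posw !big_cons !big_nil.
  by rewrite ![f _]fg.
have := fR _ _ (BraidBraid s ij); rewrite !word_eval_posw !big_cons !big_nil.
by rewrite ![f _]fg.
Qed.

Section Relations.
Local Open Scope group_scope.
Variables (e r : nat) (G : groupType).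

Lemma dual_family_of_bmr (f : bmr_gen r -> G) (x : bmr_gen r) :
  dual_family f (dual_of_bmr x) = f x.
Proof. by case: x => //=; rewrite mulgK. Qed.

Lemma satisfies_dual_family (f : bmr_gen r -> G) :
    0 < e -> satisfies (@bmr_rel e r) f ->
  satisfies (@dual_rel e r) (dual_family f).
Proof.
(* Writing e = n+1 turns the exponent e-1 of (R_2) into n. *)
case: e => // n _ fR.
have tP := const_prod_seqP (f bmr_t0) (f bmr_t1).
have zD : commute (f bmr_z) (f bmr_t1 * f bmr_t0).
  have := fR _ _ (BMR_R1 _ _).
  by rewrite !word_eval_posw !big_cons !big_nil !mulg1 /commute !mulgA.
have sD (j : sidx r) : 4 <= val j ->
    commute (f (bmr_s j)) (f bmr_t0) /\ commute (f (bmr_s j)) (f bmr_t1).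
  move=> j4; split.
    have := fR _ _ (BMR_R6 _ j4 (or_introl erefl)).
    by rewrite !word_eval_posw !big_cons !big_nil !mulg1.
  have := fR _ _ (BMR_R6 _ j4 (or_intror erefl)).
  by rewrite !word_eval_posw !big_cons !big_nil !mulg1.
move=> _ _ [u v uv|i j|s3 i s3E|j i j4|i|j].
- apply: (satisfies_usual_braid (s := @bmr_s r) (f := f)) uv => // u1 v1 uv1.
  apply: fR; exact: BMR_braid.
- rewrite !word_eval_posw !big_cons !big_nil /= !mulg1.
  rewrite -{1}[i](GRing.subrK 1%R) -{1}[j](GRing.subrK 1%R).
  by rewrite !tP.
- rewrite !word_eval_posw !big_cons !big_nil /= !mulg1 !mulgA.
  apply: (const_prod_braided tP).
  + have := fR _ _ (BMR_R5 _ s3E).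
    by rewrite !word_eval_posw !big_cons !big_nil !mulg1 !mulgA.
  + have := fR _ _ (BMR_R4 _ s3E (or_introl erefl)).
    by rewrite !word_eval_posw !big_cons !big_nil !mulg1 /braided !mulgA.
  + have := fR _ _ (BMR_R4 _ s3E (or_intror erefl)).
    rewrite const_prod_seq1.
    by rewrite !word_eval_posw !big_cons !big_nil !mulg1 /braided !mulgA.
- rewrite !word_eval_posw !big_cons !big_nil /= !mulg1.
  apply: (const_prod_commute tP); last by have [] := sD j j4.
  by have [] := sD j j4; move=> s0 s1; exact: commuteM.
- rewrite !word_eval_posw !big_cons !big_nil /= !mulg1.
  (* It suffices to treat i = e, where (Q_4) reads z t_e = t_0 z. *)
  apply: (const_prod_shift tP (j := n.+1)) => //; rewrite GRing.subrr.
  have := fR _ _ (BMR_R2 _ _).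
  have cycE m : \prod_(x <- cyclic_prod [:: bmr_t1; bmr_t0] m) f x =
      \prod_(x <- cyclic_prod [:: const_prod_seq (f bmr_t0) (f bmr_t1) 1%R;
         const_prod_seq (f bmr_t0) (f bmr_t1) 0%R] m) x.
    by rewrite const_prod_seq1 -(map_cyclic_prod f [:: _; _]) big_map.
  rewrite !word_eval_posw big_cons cycE (const_prod_cyclic tP) 2!big_cons cycE.
  (* Both sides of (R_2) now end in the same cyclic product of length n, which cancels. *)
  by rewrite !mulgA => /mulIg.
- have := fR _ _ (BMR_R3 _ j).
  by rewrite !word_eval_posw !big_cons !big_nil /= !mulg1.
Qed.

(** * From the relations (Q) back to the relations (R) *)

Section DualFamily.
Variables (h : dual_gen r -> G) (hR : satisfies (@dual_rel e r) h).

Lemma dual_rel_const_prod (i : int) :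
  h (dual_t (i + 1)%R) * h (dual_t i) = h (dual_t 1%R) * h (dual_t 0%R).
Proof.
have := hR (Dual_Q1 _ _ (i + 1)%R 1%R).
by rewrite !word_eval_posw !big_cons !big_nil !mulg1 GRing.addrK GRing.subrr.
Qed.

(** By (Q_1) the values of [h] on the t_i have constant product, so those at 0 and 1 determine the
    rest. *)
Lemma dual_family_dual_of_bmr : dual_family (h \o @dual_of_bmr r) =1 h.
Proof.
case=> //= i; apply: (const_prod_uniq (u := const_prod_seq _ _)
  (v := fun i => h (dual_t i)) _ dual_rel_const_prod) => //.
exact: const_prod_seqP.
Qed.

Lemma satisfies_dual_of_bmr :
  0 < e -> satisfies (@bmr_rel e r) (h \o @dual_of_bmr r).
Proof.
case: e hR dual_rel_const_prod => // n hR' tP _.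
have zt i : h dual_z * h (dual_t i) = h (dual_t (i - n.+1%:Z)%R) * h dual_z.
  have := hR' _ _ (Dual_Q4 _ _ i).
  by rewrite !word_eval_posw !big_cons !big_nil !mulg1.
have st (s3 : sidx r) i : val s3 = 3 -> braided (h (dual_s s3)) (h (dual_t i)).
  move=> s3E; have := hR' _ _ (Dual_Q2 _ i s3E).
  by rewrite !word_eval_posw !big_cons !big_nil !mulg1 /braided !mulgA.
move=> _ _ [u v uv|||j|s3 t s3E tE|s3 s3E|j t j4 tE].
- apply: (satisfies_usual_braid (s := @dual_s r) (f := h)) uv => // u1 v1 uv1.
  apply: hR'; exact: Dual_braid.
- rewrite !word_eval_posw !big_cons !big_nil /= !mulg1.
  (* Moving z to the right turns t_1 t_0 into t_(1-e) t_(-e), which is again the constant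
     product. *)
  rewrite mulgA zt -mulgA zt !mulgA -(tP (0 - n.+1%:Z)%R).
  by rewrite GRing.addrAC.
- have cycE m : \prod_(x <- cyclic_prod [:: bmr_t1; bmr_t0] m)
        (h \o @dual_of_bmr r) x =
      \prod_(x <- cyclic_prod [:: h (dual_t 1%R); h (dual_t 0%R)] m) x.
    rewrite -(big_map (h \o @dual_of_bmr r) xpredT id).
    by rewrite map_cyclic_prod.
  rewrite !word_eval_posw big_cons cycE.
  rewrite (const_prod_cyclic (u := fun i => h (dual_t i)) tP) 2!big_cons cycE.
  by rewrite /= !mulgA zt GRing.subrr.
- have := hR' _ _ (Dual_Q5 _ j).
  by rewrite !word_eval_posw !big_cons !big_nil /= !mulg1.
- rewrite !word_eval_posw !big_cons !big_nil /= !mulg1 !mulgA.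
  by case: tE => ->; exact: st.
- rewrite !word_eval_posw !big_cons !big_nil /= !mulg1 !mulgA.
  (* Here a = t_1, b = t_0 and c = t_2: (R_5) follows from (Q_2) at three consecutive indices. *)
  have := (braided_R5 (tP 1%R) (st _ 1%R s3E) (st _ 0%R s3E)).1 (st _ _ s3E).
  by rewrite !mulgA.
- have sj i := hR' _ _ (Dual_Q3 _ i j4).
  by case: tE => ->; [have := sj 0%R | have := sj 1%R];
    rewrite !word_eval_posw !big_cons !big_nil.
Qed.

End DualFamily.
End Relations.

(** The images under [h] again form a sequence with constant product and the expected term at 0, so
    uniqueness applies. *)
Lemma dual_family_morph (r : nat) (G H : groupType) (h : G -> H)
    (f : bmr_gen r -> G) :
    {morph h : x y / (x * y)%g} -> h \o dual_family f =1 dual_family (h \o f).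
Proof.
move=> hM [|i|j] //=.
apply: (const_prod_uniq (u := h \o const_prod_seq (f bmr_t0) (f bmr_t1))) => //.
  by move=> k; rewrite /= -hM const_prod_seqP hM.
exact: const_prod_seqP.
Qed.

Theorem theorem3p2 (d e r : nat) (hd : 2 <= d) (hr : 2 <= r) (he : 1 <= e) :
  exists gen : dual_gen r -> braid_group d e r,
    [/\ gen dual_z = bg_gen d e bmr_z,
        gen (dual_t 0%R) = bg_gen d e bmr_t0,
        gen (dual_t 1%R) = bg_gen d e bmr_t1,
        forall j : sidx r, gen (dual_s j) = bg_gen d e (bmr_s j)
      & has_presentation gen (@dual_rel e r)].
Proof.
exists (dual_family (@bg_gen d e r)); split=> //; first exact: const_prod_seq1.
have genR := satisfies_dual_family he (@satisfies_pres_gen _ (@bmr_rel e r)).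
have dualR := @satisfies_pres_gen _ (@dual_rel e r).
have invR := satisfies_dual_of_bmr dualR he.
apply: (has_presentation_lift genR invR) => [x|y].
(* Pushed through the lift, the t_i become the sequence built from the dual generators t_0 and t_1;
   (Q_1) identifies it with the dual generators themselves. *)
- have /= -> := dual_family_morph (@bg_gen d e r) (pres_liftM invR) x.
  rewrite -[RHS](dual_family_dual_of_bmr dualR).
  by case: x => //= [|i|j]; rewrite !(pres_lift_gen invR).
- by rewrite /= (pres_lift_gen genR) dual_family_of_bmr.
Qed.
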